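(* There exists a constant $C>0$ such that for every locally integrable function $f:\mathbb{R}\rightarrow\mathbb{R}$ which is even and nonincreasing on $(0,\infty)$ we have \[ \operatorname{var}((\mathcal{M}f)')\leq C\operatorname{var}(f'). \]
   Context: The uncentered Hardy-Littlewood maximal function (defined without absolute values) of $f:\mathbb{R}\to\mathbb{R}$ is \[ \mathcal{M}f(x)=\sup_{a<x<b}\frac1{b-a}\int_a^b f(y)\,\mathrm{d}y . \] For a locally integrable $g$ on $\mathbb{R}$, $\operatorname{var}(g)=\sup\{-\int_{\mathbb{R}}g\varphi':\varphi\in C^1_{\mathrm c}(\mathbb{R}),\ |\varphi|\leq1\}$. The derivative is taken in the distributional sense, so for locally integrable $h$ one has $\operatorname{var}(h')=\sup\{\int_{\mathbb{R}} h\varphi'':\varphi\in C^2_{\mathrm c}(\mathbb{R}),\ |\varphi|\leq1\}$, which agrees with $\operatorname{var}$ of the weak derivative when $h$ is weakly differentiable. The inequality is regarded as trivially true when $\operatorname{var}(f')=\infty$. *)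

(* Defs.v *)
From HB Require Import structures.
From mathcomp Require Export all_boot all_order all_algebra.
From mathcomp Require Export all_classical all_reals all_analysis.
Export Order.TTheory GRing.Theory Num.Theory.
Export numFieldNormedType.Exports.

Set Implicit Arguments.
Unset Strict Implicit.
Unset Printing Implicit Defensive.

Local Open Scope classical_set_scope.
Local Open Scope ring_scope.
Local Open Scope ereal_scope.

Section Defs.
Context {R : realType}.
Notation mu := (@lebesgue_measure R).

Definition average (f : R -> R) (a b : R) : \bar R :=
  ((b - a)^-1)%:E * \int[mu]_(y in `[a, b]) (f y)%:E.

(* The supremum is taken in \bar R, since it may be infinite: for instance at
   x = 0 for f y = |y|^(-1/2). *)
Definition maximal (f : R -> R) (x : R) : \bar R :=
  ereal_sup [set average f p.1 p.2 | p in [set p : R * R | p.1 < x < p.2]%R].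

Definition C2c (phi : R -> R) : Prop :=
  [/\ forall x, derivable phi x 1%R,
      forall x, derivable (derive1 phi) x 1%R,
      continuous (derive1n 2 phi) &
      compact (closure [set x | phi x != 0%R])].

Definition test2 (phi : R -> R) : Prop :=
  C2c phi /\ forall x, (`|phi x| <= 1)%R.

(* [locally_integrable] is only available for real-valued functions. *)
Definition elocally_integrable (h : R -> \bar R) : Prop :=
  forall K : set R, compact K -> mu.-integrable K h.

(* The variation of the distributional derivative h'. It is defined for locally
   integrable h; for other h the supremum has no meaning and the value is +oo
   by convention, so that a finite bound on [var_deriv h] includes the local
   integrability of h. *)
Definition var_deriv (h : R -> \bar R) : \bar R :=
  if `[< elocally_integrable h >] then
    ereal_sup [set \int[mu]_x (h x * (derive1n 2 phi x)%:E) | phi in test2]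
  else +oo.

End Defs.

(* Main.v *)
Require Import Defs.
From mathcomp Require Import measurable_realfun ring lra.

Set Implicit Arguments.
Unset Strict Implicit.
Unset Printing Implicit Defensive.

Local Open Scope classical_set_scope.
Local Open Scope ring_scope.

(** Why the theorem is true.  Let [V] be the variation of [f'], let [F] be the
primitive of [f] with [F 0 = 0], and write [g] for the maximal function.  If [V]
is finite then [f], with its value at [0] corrected, is [V]-Lipschitz, hence so is
[g] ([tested_lipschitz], [lipschitz_at_origin], [maximal_lipschitz]).  Since [f] is even and decreases away from the origin, for
[x > 0] the supremum is exhausted by the intervals [[-t, x]] with [0 <= t <= x]:
[g x] is the supremum of [(F x + F t) / (x + t)] ([maximal_ge], [maximal_le]).

The heart of the matter is a dilation.  If [[-t, x]] is nearly optimal at [x],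
then for [l] close to [1] the interval [[-l t, l x]] competes at [l x], and its
average is the average of [y |-> f (l y)] over the fixed interval [[-t, x]].
Hence the second difference of [g] at [x] is bounded below by the average over
[[-t, x]] of second differences of [f], the one at [y] having a step
proportional to [y].  Let [W] be the convex even function with [W'' = |f''|].
As [f + W] is convex, this average is at least [- 2 / x] times the integral
over [[0, x]] of the same second differences of [W]; undoing the dilation, this
is [-2] times the second difference at [x] of [J x = (1 / x) \int_0^x W].  So
[g + 2 J] and [J] are convex on the half-line ([regularized_comparison],
[maximal_sdiff]), and [J] is [V]-Lipschitz because [W' <= V] ([mean_lipschitz]).

Convexity gives [|D g| <= D (g + 4 J)] for second differences [D] away from the
origin, and the integral of the right-hand side telescopes to a multiple of the
Lipschitz constant of [g + 4 J]; near the origin the Lipschitz bound for [g] is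
enough ([sdiff_L1]).  An integration by parts turns this bound on the second
differences of [g] into the bound on the integrals of [g phi'']
([integral_deriv2_le]).

In general [f''] is only a measure.  So [W] is built from the double Steklov
average [f_h], whose second derivative is the second difference of [f] with step
[h] divided by [h ^+ 2]; its [L^1] norm is at most [V] by duality with test
functions ([tested_sdiff_L1]).  As [f_h] is within [V h] of [f], convexity of
[g + 2 J] holds up to an error [O(h)], and [h] tends to [0] while the step [k] of
the second differences of [g] is kept fixed. *)

(** * Antiderivatives of continuous functions *)

Section Antiderivatives.
Context {R : realType}.
Implicit Types (f g q Q : R -> R) (a b c h k x y : R).
Notation mu := (@lebesgue_measure R).

Definition antiderivative Q q := forall x, is_derive x 1 Q (q x).

(** The rules are restated for functions written as abstractions, the form in which
they occur below, rather than as sums and products in a ring of functions. *)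
Lemma derD Q1 Q2 x d1 d2 : is_derive x 1 Q1 d1 -> is_derive x 1 Q2 d2 ->
  is_derive x 1 (fun y => Q1 y + Q2 y) (d1 + d2).
Proof. by move=> ? ?; exact: is_deriveD. Qed.

Lemma derN Q x d : is_derive x 1 Q d -> is_derive x 1 (fun y => - Q y) (- d).
Proof. by move=> ?; exact: is_deriveN. Qed.

Lemma derB Q1 Q2 x d1 d2 : is_derive x 1 Q1 d1 -> is_derive x 1 Q2 d2 ->
  is_derive x 1 (fun y => Q1 y - Q2 y) (d1 - d2).
Proof. by move=> ? ?; exact: is_deriveB. Qed.

Lemma derM Q1 Q2 x d1 d2 : is_derive x 1 Q1 d1 -> is_derive x 1 Q2 d2 ->
  is_derive x 1 (fun y => Q1 y * Q2 y) (Q1 x * d2 + Q2 x * d1).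
Proof. by move=> ? ?; exact: is_deriveM. Qed.

Lemma der_cst c x : is_derive x 1 (fun=> c : R) 0.
Proof. exact: is_derive_cst. Qed.

Lemma der_id x : is_derive x 1 (fun y : R => y) 1.
Proof. exact: is_derive_id. Qed.

Lemma derZ c Q x d : is_derive x 1 Q d -> is_derive x 1 (fun y => c * Q y) (c * d).
Proof.
by move=> dQ; apply: (is_derive_eq (derM (der_cst c x) dQ)); rewrite mulr0 addr0.
Qed.

Lemma der_affine Q c k x d : is_derive (c * x + k) 1 Q d ->
  is_derive x 1 (fun y => Q (c * y + k)) (c * d).
Proof.
move=> dQ; have dl : is_derive x 1 (fun y : R => c * y + k) c.
  by apply: (is_derive_eq (derD (derZ c (der_id x)) (der_cst k x))); rewrite mulr1 addr0.
by apply: (is_derive_eq (is_derive1_comp (g := fun y : R => c * y + k) dQ dl)); rewrite mulrC.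
Qed.

Lemma der_shift Q k x d : is_derive (x + k) 1 Q d ->
  is_derive x 1 (fun y => Q (y + k)) d.
Proof.
move=> dQ; have /der_affine : is_derive (1 * x + k) 1 Q d by rewrite mul1r.
rewrite mul1r; under [X in is_derive _ _ X]funext do rewrite mul1r.
by [].
Qed.

Lemma der_opp Q x d : is_derive (- x) 1 Q d ->
  is_derive x 1 (fun y => Q (- y)) (- d).
Proof.
move=> dQ; have /der_affine : is_derive (-1 * x + 0) 1 Q d by rewrite mulN1r addr0.
rewrite mulN1r; under [X in is_derive _ _ X]funext do rewrite mulN1r addr0.
by [].
Qed.

Lemma antider_eq Q q q' : antiderivative Q q -> q =1 q' -> antiderivative Q q'.
Proof. by move=> dQ qq' x; apply: is_derive_eq (dQ x) _; rewrite qq'. Qed.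

Lemma antiderD Q1 q1 Q2 q2 : antiderivative Q1 q1 -> antiderivative Q2 q2 ->
  antiderivative (fun x => Q1 x + Q2 x) (fun x => q1 x + q2 x).
Proof. by move=> d1 d2 x; exact: derD. Qed.

Lemma antiderB Q1 q1 Q2 q2 : antiderivative Q1 q1 -> antiderivative Q2 q2 ->
  antiderivative (fun x => Q1 x - Q2 x) (fun x => q1 x - q2 x).
Proof. by move=> d1 d2 x; exact: derB. Qed.

Lemma antiderN Q q : antiderivative Q q ->
  antiderivative (fun x => - Q x) (fun x => - q x).
Proof. by move=> dQ x; exact: derN. Qed.

Lemma antiderZ c Q q : antiderivative Q q ->
  antiderivative (fun x => c * Q x) (fun x => c * q x).
Proof. by move=> dQ x; exact: derZ. Qed.

Lemma antider_shift k Q q : antiderivative Q q ->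
  antiderivative (fun x => Q (x + k)) (fun x => q (x + k)).
Proof. by move=> dQ x; exact: der_shift. Qed.

Lemma antider_opp Q q : antiderivative Q q ->
  antiderivative (fun x => Q (- x)) (fun x => - q (- x)).
Proof. by move=> dQ x; exact: der_opp. Qed.

Lemma der_continuous Q q : antiderivative Q q -> continuous Q.
Proof.
move=> dQ x; apply/differentiable_continuous/derivable1_diffP.
by have [] := dQ x.
Qed.

Lemma der_mvt Q q a b : a <= b ->
  (forall y, a <= y <= b -> is_derive y 1 Q (q y)) ->
  exists2 c, a <= c <= b & Q b - Q a = q c * (b - a).
Proof.
move=> ab dQ; have [||c cab ->] := @MVT_segment R Q q a b ab.
- by move=> x xab; apply: dQ; rewrite !(itvP xab).
- apply: derivable_within_continuous => x xab.
  by have [|//] := dQ x; rewrite !(itvP xab).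
- by exists c => //; rewrite !(itvP cab).
Qed.

Lemma der_ge0 Q q a b : a <= b ->
  (forall y, a <= y <= b -> is_derive y 1 Q (q y)) ->
  (forall y, a <= y <= b -> 0 <= q y) -> Q a <= Q b.
Proof.
move=> ab dQ q0; have [c cab E] := der_mvt ab dQ.
by rewrite -subr_ge0 E mulr_ge0 ?q0// subr_ge0.
Qed.

Lemma der_eq0 Q q a b : a <= b ->
  (forall y, a <= y <= b -> is_derive y 1 Q (q y)) ->
  (forall y, a <= y <= b -> q y = 0) -> Q b = Q a.
Proof.
move=> ab dQ q0; have [c cab E] := der_mvt ab dQ.
by apply/eqP; rewrite -subr_eq0 E q0// mul0r.
Qed.

Lemma der_le Q1 q1 Q2 q2 a b : a <= b ->
  (forall y, a <= y <= b -> is_derive y 1 Q1 (q1 y)) ->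
  (forall y, a <= y <= b -> is_derive y 1 Q2 (q2 y)) ->
  (forall y, a <= y <= b -> q1 y <= q2 y) -> Q1 b - Q1 a <= Q2 b - Q2 a.
Proof.
move=> ab d1 d2 q12.
suff : Q2 a - Q1 a <= Q2 b - Q1 b by lra.
apply: (@der_ge0 (fun y => Q2 y - Q1 y) (fun y => q2 y - q1 y)) => //.
- by move=> y yab; apply: derB; [exact: d2|exact: d1].
- by move=> y yab; rewrite subr_ge0 q12.
Qed.

Lemma der_unique Q1 Q2 q a b : a <= b ->
  (forall y, a <= y <= b -> is_derive y 1 Q1 (q y)) ->
  (forall y, a <= y <= b -> is_derive y 1 Q2 (q y)) ->
  Q1 b - Q1 a = Q2 b - Q2 a.
Proof.
by move=> ab d1 d2; apply/eqP; rewrite eq_le; apply/andP; split;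
  apply: der_le ab _ _ _; eauto.
Qed.

Lemma FTC_antiderivative Q q a b : continuous q -> antiderivative Q q -> a <= b ->
  (\int[mu]_(x in `[a, b]) (q x)%:E = (Q b - Q a)%:E)%E.
Proof.
move=> cq dQ; rewrite le_eqVlt => /predU1P[->|ab].
  by rewrite set_itv1 integral_set1 subrr.
rewrite (@continuous_FTC2 _ q Q)//.
- by apply: continuous_subspaceT => x; exact: cq.
- have cQ := der_continuous dQ; split => [x _||].
  + by have [] := dQ x.
  + exact: cvg_at_right_filter (cQ a).
  + exact: cvg_at_left_filter (cQ b).
- by move=> x _; rewrite derive1E; have [] := dQ x.
Qed.

Lemma continuous_segment_integrable q a b : continuous q ->
  mu.-integrable `[a, b] (EFin \o q).
Proof.
move=> cq; apply: continuous_compact_integrable; first exact: segment_compact.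
by apply: continuous_subspaceT => x; exact: cq.
Qed.

(** The integral from the fixed lower end [- N], normalized to vanish at [0]. *)
Lemma local_antiderivative q N : continuous q ->
  exists2 Q, Q 0 = 0 & forall x, - N < x < N -> is_derive x 1 Q (q x).
Proof.
move=> cq; pose G y := (\int[mu]_(t in `[- N, y]) q t)%R.
exists (fun y => G y - G 0); first by rewrite subrr.
move=> x /andP[Nx xN].
have [dG G'] := @continuous_FTC1_closed R q (- N) x N xN
  (continuous_segment_integrable _ _ cq) Nx (cq x).
apply: (is_derive_eq (f' := q x - 0)); last by rewrite subr0.
by apply: derB (der_cst _ _); rewrite -G' derive1E; exact/derivableP.
Qed.

(** The local antiderivatives vanish at [0], hence agree where they are both
defined, and can be glued. *)
Lemma antiderivative_ex q : continuous q ->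
  exists2 Q, Q 0 = 0 & antiderivative Q q.
Proof.
move=> cq; have P N := local_antiderivative N cq.
pose G N := sval (cid2 (P N)).
have G0 N : G N 0 = 0 by rewrite /G; case: cid2.
have dG N x : - N < x < N -> is_derive x 1 (G N) (q x).
  by rewrite /G; case: cid2 => Q ? /=; exact.
have GE N M x : `|x| < N -> `|x| < M -> G N x = G M x.
  move=> xN xM; have [x0|x0] := leP 0 x.
    have : G N x - G N 0 = G M x - G M 0.
      apply: (@der_unique _ _ q) => // y y0x; apply: dG; move: xN xM;
        rewrite ger0_norm//; lra.
    by rewrite !G0 !subr0.
  have : G N 0 - G N x = G M 0 - G M x.
    apply: (@der_unique _ _ q) => //; first exact: ltW.
      by move=> y y0x; apply: dG; move: xN; rewrite ltr0_norm//; lra.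
    by move=> y y0x; apply: dG; move: xM; rewrite ltr0_norm//; lra.
  by rewrite !G0 !sub0r => /oppr_inj.
exists (fun x => G (`|x| + 1) x); first by rewrite G0.
move=> x; apply: (@near_eq_is_derive _ _ _ (G (`|x| + 2))).
- near=> y; apply: GE; last by rewrite ltrDl.
  have : `|x - y| < 1 by near: y; apply: cvgr_dist_lt.
  have := ler_normB x (x - y); rewrite opprB addrC subrK; lra.
- apply: dG; have := ler_norm x; have := ler_norm (- x); rewrite normrN; lra.
Unshelve. all: by end_near. Qed.

End Antiderivatives.

(** * Continuity and Lipschitz functions *)

Section Continuity.
Context {R : realType}.
Implicit Types f g : R -> R.

Lemma ctsD f g : continuous f -> continuous g -> continuous (fun x => f x + g x).
Proof. by move=> cf cg x; apply: (continuousD (cf x) (cg x)). Qed.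

Lemma ctsN f : continuous f -> continuous (fun x => - f x).
Proof. by move=> cf x; apply: (continuousN (cf x)). Qed.

Lemma ctsB f g : continuous f -> continuous g -> continuous (fun x => f x - g x).
Proof. by move=> cf cg; apply: ctsD => //; exact: ctsN. Qed.

Lemma ctsM f g : continuous f -> continuous g -> continuous (fun x => f x * g x).
Proof. by move=> cf cg x; apply: (continuousM (cf x) (cg x)). Qed.

Lemma cts_cst (c : R) : continuous (fun _ : R => c).
Proof. by move=> x; exact: cvg_cst. Qed.

Lemma cts_id : continuous (fun x : R => x).
Proof. by move=> x; exact: cvg_id. Qed.

Lemma ctsZ (c : R) f : continuous f -> continuous (fun x => c * f x).
Proof. by move=> cf; apply: ctsM => //; exact: cts_cst. Qed.

Lemma cts_comp f g : continuous f -> continuous g -> continuous (fun x => f (g x)).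
Proof. by move=> cf cg x; apply: (continuous_comp (cg x) (cf (g x))). Qed.

Lemma cts_shift f (k : R) : continuous f -> continuous (fun x => f (x + k)).
Proof.
by move=> cf; apply: (cts_comp cf); exact: (ctsD (g := fun=> k) cts_id (@cts_cst k)).
Qed.

Lemma cts_opp f : continuous f -> continuous (fun x => f (- x)).
Proof. by move=> cf; apply: (cts_comp cf); exact: (ctsN cts_id). Qed.

Lemma cts_norm f : continuous f -> continuous (fun x => `|f x|).
Proof. by move=> cf; apply: (cts_comp (f := Num.norm)) cf; exact: norm_continuous. Qed.

Lemma cts_inv f : (forall x, f x != 0) -> continuous f -> continuous (fun x => (f x)^-1).
Proof. by move=> f0 cf x; apply: continuousV; [exact: f0 | exact: cf]. Qed.

Lemma lipschitz_cts f (L : R) : (forall x y, `|f x - f y| <= L * `|x - y|) -> continuous f.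
Proof.
move=> Lf x; apply/cvgrPdist_le => e e0; near=> y.
apply: le_trans (Lf x y) _.
have L0 : 0 < `|L| + 1 by rewrite ltr_wpDl.
apply: (@le_trans _ _ ((`|L| + 1) * `|x - y|)).
  by rewrite ler_wpM2r// (le_trans (ler_norm L))// lerDl.
rewrite mulrC -ler_pdivlMr//; near: y.
by apply: (@cvgr_dist_le _ _ _ _ _ id); [exact: cvg_id | rewrite divr_gt0].
Unshelve. all: by end_near. Qed.

End Continuity.
Arguments cts_shift {R f} k _ x.
Arguments ctsZ {R} c {f} _ x.
Arguments cts_cst {R} c x.

(** * Second differences *)

Section SecondDifference.
Context {R : realType}.
Implicit Types (f g q Q : R -> R) (c h k x y : R).

Definition sdiff h f x := f (x + h) + f (x - h) - 2 * f x.

Lemma cts_sdiff h f : continuous f -> continuous (sdiff h f).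
Proof.
move=> cf; exact: (ctsB (ctsD (cts_shift h cf) (cts_shift (- h) cf)) (ctsZ 2 cf)).
Qed.

Lemma der_sdiff h Q q : antiderivative Q q -> antiderivative (sdiff h Q) (sdiff h q).
Proof.
by move=> dQ x; apply: derB (derZ _ (dQ x)); apply: derD; apply: der_shift.
Qed.

(** A second difference is a difference of two increments of [Q], which by the
mean value theorem are values of [Q1] at ordered points.  The sign of [q] matters
only on the window seen by the second difference. *)
Lemma sdiff_ge0 h Q Q1 q x : 0 <= h -> antiderivative Q Q1 -> antiderivative Q1 q ->
  (forall y, x - h <= y <= x + h -> 0 <= q y) -> 0 <= sdiff h Q x.
Proof.
move=> h0 dQ dQ1 q0.
have [||c1 c1h E1] := @der_mvt R Q Q1 x (x + h); [lra|by move=> y _; exact: dQ|].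
have [||c2 c2h E2] := @der_mvt R Q Q1 (x - h) x; [lra|by move=> y _; exact: dQ|].
have c21 : Q1 c2 <= Q1 c1.
  apply: (@der_ge0 _ Q1 q) => [|y _|y yc]; [lra|exact: dQ1|apply: q0; lra].
rewrite (_ : sdiff h Q x = h * (Q1 c1 - Q1 c2)); first by rewrite mulr_ge0// subr_ge0.
by rewrite /sdiff; lra.
Qed.

(** Convexity of the parabola [c y^2 / 2] minus [Q]. *)
Lemma sdiff_le h Q Q1 q x c : 0 <= h -> antiderivative Q Q1 -> antiderivative Q1 q ->
  (forall y, x - h <= y <= x + h -> q y <= c) -> sdiff h Q x <= c * h ^+ 2.
Proof.
move=> h0 dQ dQ1 qc.
have := @sdiff_ge0 h (fun y => c / 2 * (y * y) - Q y) (fun y => c * y - Q1 y)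
  (fun y => c - q y) x h0.
suff : sdiff h (fun y => c / 2 * (y * y) - Q y) x = c * h ^+ 2 - sdiff h Q x.
  move=> -> H; rewrite -subr_ge0; apply: H.
  - move=> y; apply: derB (dQ y).
    apply: is_derive_eq (derZ _ (derM (der_id y) (der_id y))) _; lra.
  - by move=> y; apply: derB (dQ1 y); apply: is_derive_eq (derZ _ (der_id y)) _; lra.
  - by move=> y yh; rewrite subr_ge0 qc.
by rewrite /sdiff; field.
Qed.

Lemma sdiffN h f x : sdiff h (fun y => - f y) x = - sdiff h f x.
Proof. by rewrite /sdiff; ring. Qed.

Lemma sdiff_norm_le h Q Q1 q x c : 0 <= h -> antiderivative Q Q1 -> antiderivative Q1 q ->
  (forall y, x - h <= y <= x + h -> `|q y| <= c) -> `|sdiff h Q x| <= c * h ^+ 2.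
Proof.
move=> h0 dQ dQ1 qc; rewrite ler_norml lerNl -sdiffN; apply/andP; split.
  apply: (@sdiff_le h _ (fun y => - Q1 y) (fun y => - q y)) => // [y|y|y yh].
  - exact: derN.
  - exact: derN.
  - by rewrite (le_trans (ler_norm _))// normrN qc.
apply: (sdiff_le h0 dQ dQ1) => y yh; exact: le_trans (ler_norm _) (qc y yh).
Qed.

Lemma sdiff_eq0 h Q Q1 q x : 0 <= h -> antiderivative Q Q1 -> antiderivative Q1 q ->
  (forall y, x - h <= y <= x + h -> q y = 0) -> sdiff h Q x = 0.
Proof.
move=> h0 dQ dQ1 q0; apply/normr0_eq0/le_anti; rewrite normr_ge0 andbT.
rewrite (le_trans (sdiff_norm_le (c := 0) h0 dQ dQ1 _)) ?mul0r//.
by move=> y /q0 ->; rewrite normr0.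
Qed.

End SecondDifference.

(** * Test functions *)

Section TestFunctions.
Context {R : realType}.
Implicit Types (f psi : R -> R) (A V : R).
Notation mu := (@lebesgue_measure R).

Lemma derive1_antiderivative psi psi1 : antiderivative psi psi1 -> derive1 psi = psi1.
Proof. by move=> d; apply/funext => x; rewrite derive1E; have [] := d x. Qed.

Lemma integral_supported_segment (u : R -> \bar R) A : (forall x, A < `|x| -> u x = 0%E) ->
  (\int[mu]_x u x = \int[mu]_(x in `[(- A)%R, A]) u x)%E.
Proof.
move=> u0; rewrite [RHS]integral_mkcond; apply: eq_integral => x _.
rewrite patchE; case: ifPn => // /negP xA; apply: u0.
rewrite ltNge; apply/negP => xleA; apply: xA.
by rewrite inE/= in_itv/= -ler_norml.
Qed.

Lemma test2_antiderivative psi psi1 psi2 A :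
  antiderivative psi psi1 -> antiderivative psi1 psi2 -> continuous psi2 ->
  (forall x, `|psi x| <= 1) -> (forall x, A < `|x| -> psi x = 0) -> test2 psi.
Proof.
move=> d1 d2 c2 psi_le1 psi0; split => //.
rewrite /C2c /= (derive1_antiderivative d1); split.
- by move=> x; have [] := d1 x.
- by move=> x; have [] := d2 x.
- by rewrite (derive1_antiderivative d2).
- apply: (subclosed_compact _ (@segment_compact _ (- A) A)); first exact: closed_closure.
  rewrite closureE; apply: smallest_sub; first exact: itv_closed.
  move=> x /= /eqP px; rewrite in_itv/= -ler_norml leNgt; apply/negP => /psi0.
  exact: px.
Qed.

Lemma test2_support psi : test2 psi -> exists A, [/\ 0 < A,
  (forall x, A < `|x| -> psi x = 0), (forall x, A < `|x| -> derive1 psi x = 0) &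
  (forall x, A < `|x| -> derive1n 2 psi x = 0)].
Proof.
case=> -[d1 d2 c2 /compact_bounded [M [_ HM]]] _.
pose A := `|M| + 1.
have psi0 x : A < `|x| -> psi x = 0.
  move=> xA; apply/eqP; apply: contraLR xA => px; rewrite -leNgt; apply: HM.
    by rewrite (le_lt_trans (ler_norm M))// ltrDl.
  exact: subset_closure.
have near0 (u : R -> R) : (forall x, A < `|x| -> u x = 0) ->
    forall x, A < `|x| -> derive1 u x = 0.
  move=> u0 x Ax; rewrite derive1E.
  suff [_ ->] : is_derive x 1 u 0 by [].
  apply: (@near_eq_is_derive _ _ _ (fun _ : R => 0 : R)).
  have : \forall y \near x, A < `|y|.
    have cn : `|y| @[y --> x] --> `|x| by exact: (@norm_continuous _ R^o).
    exact: (cvgr_gt _ cn).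
  by apply: filterS => y /u0 ->.
exists A; split => //; first by rewrite ltr_wpDl.
  exact: near0.
by apply: (near0 _ (near0 _ psi0)).
Qed.

(** This says that the variation of the distributional derivative of [f] is at
most [V], without the convention on local integrability. *)
Definition tested f V := forall psi, test2 psi ->
  (\int[mu]_x ((f x)%:E * (derive1n 2 psi x)%:E) <= V%:E)%E.

Lemma tested_segment f V psi psi1 psi2 A : tested f V ->
  antiderivative psi psi1 -> antiderivative psi1 psi2 -> continuous psi2 ->
  (forall x, `|psi x| <= 1) -> (forall x, A < `|x| -> psi x = 0) ->
  (forall x, A < `|x| -> psi2 x = 0) ->
  (\int[mu]_(x in `[(- A)%R, A]) (f x * psi2 x)%:E <= V%:E)%E.
Proof.
move=> Hf d1 d2 c2 psi_le1 psi0 psi20.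
have := Hf psi (test2_antiderivative d1 d2 c2 psi_le1 psi0).
rewrite (_ : derive1n 2 psi = psi2); last first.
  by rewrite /derive1n/= (derive1_antiderivative d1) (derive1_antiderivative d2).
by rewrite (@integral_supported_segment _ A)// => x /psi20 ->; rewrite mule0.
Qed.

End TestFunctions.

(** * Lipschitz bound away from the origin *)

Lemma le_linear_eps (R : realType) (x y c d : R) : 0 < d ->
  (forall e, 0 < e < d -> x <= y + c * e) -> x <= y.
Proof.
move=> d0 H; rewrite leNgt; apply/negP => yx.
have c0 : 0 < `|c| + 1 by rewrite ltr_wpDl.
pose e := Num.min (d / 2) ((x - y) / 2 / (`|c| + 1)).
have e0 : 0 < e.
  by rewrite lt_min !divr_gt0//= subr_gt0.
have ed : e < d by rewrite /e gt_min; apply/orP; left; lra.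
have := H e; rewrite e0 ed => /(_ isT).
have : c * e <= (`|c| + 1) * e.
  apply: ler_wpM2r; first exact: ltW.
  by rewrite (le_trans (ler_norm c))// lerDl.
have : (`|c| + 1) * e <= (x - y) / 2.
  by rewrite mulrC -ler_pdivlMr// /e ge_min lexx orbT.
lra.
Qed.

Section Lipschitz.
Context {R : realType}.
Notation mu := (@lebesgue_measure R).

(** Twice the positive part of a parabola: a continuous bump on [[a - eta, a]]. *)
Definition pbump (a eta : R) (x : R) :=
  (x - (a - eta)) * (a - x) + `|(x - (a - eta)) * (a - x)|.

Lemma cts_pbump a eta : continuous (pbump a eta).
Proof.
have c1 : continuous (fun x : R => (x - (a - eta)) * (a - x)).
  apply: ctsM; first exact: (ctsB cts_id (cts_cst (a - eta))).
  exact: (ctsB (cts_cst a) cts_id).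
exact: ctsD c1 (cts_norm c1).
Qed.

Lemma pbump_ge0 a eta x : 0 <= pbump a eta x.
Proof. by rewrite /pbump -lerBlDl sub0r -normrN ler_norm. Qed.

Lemma pbump_out a eta x : 0 < eta -> ~~ (a - eta < x < a) -> pbump a eta x = 0.
Proof.
move=> eta0 xN; rewrite /pbump ler0_norm ?subrr//.
move: xN; rewrite negb_and -!leNgt => /orP[] H.
  by rewrite mulr_le0_ge0//; lra.
by rewrite mulr_ge0_le0//; lra.
Qed.

Lemma pbump_in a eta x : a - eta * 3 / 4 <= x <= a - eta / 4 -> 0 < eta -> 0 < pbump a eta x.
Proof.
move=> xI eta0; have : 0 < (x - (a - eta)) * (a - x) by rewrite mulr_gt0//; lra.
by move=> H; rewrite /pbump gtr0_norm// addr_gt0.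
Qed.

Lemma pbump_antiderivative a eta : 0 < eta -> exists B m, [/\ 0 < m,
  antiderivative B (pbump a eta), forall x, x <= a - eta -> B x = 0,
  forall x, a <= x -> B x = m & forall x, 0 <= B x <= m].
Proof.
move=> eta0; have [B0 _ dB0] := antiderivative_ex (@cts_pbump a eta).
pose B x := B0 x - B0 (a - eta).
have dB : antiderivative B (pbump a eta).
  by move=> x; apply: is_derive_eq (derB (dB0 x) (der_cst _ _)) _; rewrite subr0.
have mono x y : x <= y -> B x <= B y.
  by move=> xy; apply: (@der_ge0 _ B (pbump a eta)) => // z _; exact: pbump_ge0.
have low x : x <= a - eta -> B x = 0.
  move=> xa; apply/eqP; rewrite subr_eq0 eq_sym; apply/eqP.
  apply: (@der_eq0 _ B0 (pbump a eta)) => // y yI; rewrite pbump_out//.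
  by rewrite negb_and -!leNgt; apply/orP; left; lra.
have high x : a <= x -> B x = B a.
  move=> xa; apply: (@der_eq0 _ B (pbump a eta)) => // y yI; rewrite pbump_out//.
  by rewrite negb_and -!leNgt; apply/orP; right; lra.
exists B, (B a); split => // [|x].
  have [||c cI E] := @der_mvt _ B (pbump a eta) (a - eta * 3 / 4) (a - eta / 4).
  - lra.
  - by move=> y _; exact: dB.
  - have m1 : B (a - eta / 4) <= B a by apply: mono; lra.
    have m2 : 0 <= B (a - eta * 3 / 4).
      by rewrite -(low (a - eta))//; apply: mono; lra.
    have : 0 < pbump a eta c * (a - eta / 4 - (a - eta * 3 / 4)).
      by rewrite mulr_gt0 ?pbump_in//; lra.
    rewrite -E; lra.
apply/andP; split.
  have [xa|xa] := leP x (a - eta); first by rewrite low.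
  by rewrite -(low (a - eta))//; apply: mono; lra.
by have [xa|xa] := leP x a; [exact: mono | rewrite high// ltW].
Qed.

(** The test function is an upside-down plateau: with [B] the normalized primitive of a bump
just left of [a], it is the sum of the averages of [B] over the windows
[[x - w, x]] and [[- x - w, - x]], minus [1].  Its second derivative is
positive just left of [a], negative just right of [b], and symmetric; monotonicity
of [f] then bounds the tested integral below by [2 (f a - f b) / w]. *)
Lemma tested_lipschitz (f : R -> R) (V a b : R) : elocally_integrable (EFin \o f) ->
  (forall x, f (- x) = f x) -> (forall x y : R, 0 < x -> x <= y -> f y <= f x) ->
  tested f V -> 0 < a -> a < b -> 2 * (f a - f b) <= V * (b - a).
Proof.
move=> fi fe fm fV a0 ab; apply: (@le_linear_eps _ _ _ V a) => // eta /andP[eta0 etaa].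
have [B [m [m0 dB low high B01]]] := pbump_antiderivative a eta0.
have cB : continuous B := der_continuous dB.
have [B2 _ dB2] := antiderivative_ex cB.
(* the two bumps of the second derivative are translates of each other by [w] *)
have [w wE] : exists w, w = b + eta - a by eexists.
have w0 : 0 < w by rewrite wE; lra.
pose beta := pbump a eta.
have cbeta : continuous beta by exact: cts_pbump.
pose k := (w * m)^-1; have k0 : 0 < k by rewrite invr_gt0 mulr_gt0.
pose psi x := k * ((B2 x - B2 (x - w)) + (B2 (- x) - B2 (- x - w))) - 1.
pose psi1 x := k * ((B x - B (x - w)) + (- B (- x) - - B (- x - w))).
pose psi2 x := k * ((beta x - beta (x - w)) + (beta (- x) - beta (- x - w))).
have dB2w := antider_shift (- w) dB2; have dBw := antider_shift (- w) dB.
have d1 : antiderivative psi psi1.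
  apply: (antider_eq (antiderB (antiderZ k (antiderD (antiderB dB2 dB2w)
    (antiderB (antider_opp dB2) (antider_opp dB2w)))) (der_cst 1))) => x.
  by rewrite subr0.
have d2 : antiderivative psi1 psi2.
  apply: (antider_eq (antiderZ k (antiderD (antiderB dB dBw)
    (antiderB (antiderN (antider_opp dB)) (antiderN (antider_opp dBw)))))) => x.
  by rewrite !opprK.
have c2 : continuous psi2.
  have cw := cts_shift (- w) cbeta.
  exact: (ctsZ k (ctsD (ctsB cbeta cw) (ctsB (cts_opp cbeta) (cts_opp cw)))).
have avg x : exists2 c, x - w <= c <= x & B2 x - B2 (x - w) = B c * w.
  have [||c cI E] := @der_mvt _ B2 B (x - w) x; first lra.
    by move=> y _; exact: dB2.
  by exists c => //; rewrite E opprB addrCA subrr addr0.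
have psi_le1 x : `|psi x| <= 1.
  have [c _ Ec] := avg x; have [c' _ Ec'] := avg (- x).
  have -> : psi x = (B c + B c') / m - 1.
    by rewrite /psi Ec Ec' /k; field; rewrite !gt_eqF.
  have /andP[? ?] := B01 c; have /andP[? ?] := B01 c'.
  have : 0 <= (B c + B c') / m by apply: divr_ge0; [lra|exact: ltW].
  have : (B c + B c') / m <= 2 by rewrite ler_pdivrMr//; lra.
  by rewrite ler_norml; lra.
pose A := a + w.
have psi_even x : psi (- x) = psi x by rewrite /psi opprK addrC [in RHS]addrC; congr (_ + _ * _); rewrite addrC.
have psi2_even x : psi2 (- x) = psi2 x by rewrite /psi2 opprK; congr (_ * _); rewrite addrC.
have wlog0 (u : R -> R) : (forall x, u (- x) = u x) -> (forall x, A < x -> u x = 0) ->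
    forall x, A < `|x| -> u x = 0.
  move=> ue u0 x; have [x0|x0] := leP 0 x; first by rewrite ger0_norm//; exact: u0.
  by rewrite ltr0_norm// -ue; exact: u0.
have psi0 : forall x, A < `|x| -> psi x = 0.
  apply: wlog0 => // x; rewrite /A => Ax.
  have [c cI Ec] := avg x; have [c' cI' Ec'] := avg (- x).
  rewrite /psi Ec Ec' high ?low; [|lra|lra].
  by rewrite /k; field; rewrite !gt_eqF.
have psi20 : forall x, A < `|x| -> psi2 x = 0.
  apply: wlog0 => // x; rewrite /A => Ax.
  rewrite /psi2 /beta !pbump_out ?subrr ?addr0 ?mulr0// negb_and -!leNgt;
    apply/orP; solve [left; lra | right; lra].
have := tested_segment fV d1 d2 c2 psi_le1 psi0 psi20.
(* [G] is obtained from [f * psi2] by freezing [f] at [a] and at [b] on the bumps *)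
pose G x := k * (f a * (beta x + beta (- x)) - f b * (beta (x - w) + beta (- x - w))).
pose Gi x := k * (f a * (B x + - B (- x)) - f b * (B (x - w) + - B (- x - w))).
have cG : continuous G.
  have cw := cts_shift (- w) cbeta.
  exact: (ctsZ k (ctsB (ctsZ _ (ctsD cbeta (cts_opp cbeta)))
    (ctsZ _ (ctsD cw (cts_opp cw))))).
have dG : antiderivative Gi G.
  apply: (antider_eq (antiderZ k (antiderB
    (antiderZ (f a) (antiderD dB (antiderN (antider_opp dB))))
    (antiderZ (f b) (antiderD dBw (antiderN (antider_opp dBw))))))) => x.
  by rewrite !opprK.
have GE x : G x <= f x * psi2 x.
  have fa y : f a * beta y <= f y * beta y.
    rewrite /beta; have [yI|yN] := boolP (a - eta < y < a).
      by rewrite ler_wpM2r ?pbump_ge0//; apply: fm; lra.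
    by rewrite pbump_out// !mulr0.
  have fb y : f y * beta (y - w) <= f b * beta (y - w).
    rewrite /beta; have [yI|yN] := boolP (a - eta < y - w < a).
      by rewrite ler_wpM2r ?pbump_ge0//; apply: fm => //; move: yI; rewrite wE; lra.
    by rewrite pbump_out// !mulr0.
  rewrite /G /psi2 mulrCA; apply: ler_wpM2l; first exact: ltW.
  have := fa x; have := fa (- x); have := fb x; have := fb (- x); rewrite !fe; lra.
have A0 : 0 < A by rewrite /A; lra.
have le_int : (\int[mu]_(x in `[(- A)%R, A]) (G x)%:E <=
    \int[mu]_(x in `[(- A)%R, A]) (f x * psi2 x)%:E)%E.
  apply: le_integral => //.
  - exact: continuous_segment_integrable.
  - have fA := fi _ (@segment_compact _ (- A) A).
    apply: (@integrableMl _ _ _ mu _ _ (EFin \o f) psi2 fA) => //.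
      by apply: measurable_funTS; exact: continuous_measurable_fun.
    have [M [Mr HM]] := compact_bounded (continuous_compact
      (continuous_subspaceT (A := `[- A, A]) c2) (@segment_compact _ (- A) A)).
    by exists M; split => // y My x xA; apply: HM => //; exists x.
  - by move=> x _; rewrite lee_fin.
move=> /(le_trans le_int); rewrite (FTC_antiderivative cG dG); last by lra.
rewrite lee_fin.
have -> : Gi A - Gi (- A) = 2 * (f a - f b) / w.
  rewrite /Gi opprK.
  rewrite (high A) ?(low (- A)) ?(high (A - w)) ?(low (- A - w)); try by rewrite /A ?wE; lra.
  by rewrite /k; field; rewrite !gt_eqF.
rewrite ler_pdivrMr// wE; lra.
Qed.

End Lipschitz.

(** * Second differences of f are bounded in L^1 *)

Section SecondDifferenceL1.
Context {R : realType}.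
Notation mu := (@lebesgue_measure R).
Implicit Types (f phi : R -> R) (V h A : R).

(** A merely continuous [phi] becomes a test function after two Steklov averages
of step [h]; by translation the second difference moves from [phi] to [f]. *)
Lemma tested_sdiff f phi V h A (Y : R -> R) : continuous f -> tested f V -> 0 < h ->
  continuous phi -> (forall x, `|phi x| <= 1) -> (forall x, A <= `|x| -> phi x = 0) ->
  antiderivative Y (fun x => phi x * sdiff h f x) ->
  0 <= A -> Y (A + h) - Y (- (A + h)) <= V * h ^+ 2.
Proof.
move=> cf fV h0 cphi phi1 phi0 dY A0.
have [Phi1 _ dPhi1] := antiderivative_ex cphi.
have [Phi2 _ dPhi2] := antiderivative_ex (der_continuous dPhi1).
have h20 : 0 < h ^+ 2 by rewrite exprn_gt0.
pose k := (h ^+ 2)^-1; have k0 : 0 < k by rewrite invr_gt0.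
have d1 := antiderZ k (der_sdiff h dPhi2).
have d2 := antiderZ k (der_sdiff h dPhi1).
have c2 := ctsZ k (cts_sdiff (h := h) cphi).
have sd_out x : A + h < `|x| -> forall y, x - h <= y <= x + h -> phi y = 0.
  move=> Ax y yx; apply: phi0; have := ler_normD y (x - y).
  have : `|x - y| <= h by rewrite ler_norml; lra.
  by rewrite addrCA subrr addr0; lra.
have bound x : `|k * sdiff h Phi2 x| <= 1.
  rewrite normrM gtr0_norm// -ler_pdivlMl// invrK mulr1 -[leRHS]mul1r.
  by apply: (sdiff_norm_le (ltW h0) dPhi2 dPhi1) => y _.
have out0 x : A + h < `|x| -> k * sdiff h Phi2 x = 0.
  by move=> Ax; rewrite (sdiff_eq0 (ltW h0) dPhi2 dPhi1 (sd_out _ Ax)) mulr0.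
have out2 x : A + h < `|x| -> k * sdiff h phi x = 0.
  by move=> /sd_out Ax; rewrite /sdiff !Ax ?subr0 ?addr0 ?mulr0//; lra.
have := tested_segment fV d1 d2 c2 bound out0 out2.
pose u x := f (x - h) * phi x; pose w x := f (x + h) * phi x; pose z x := f x * phi x.
have cu : continuous u by exact: ctsM (cts_shift (- h) cf) cphi.
have cw : continuous w by exact: ctsM (cts_shift h cf) cphi.
have cz : continuous z by exact: ctsM cf cphi.
have [U _ dU] := antiderivative_ex cu.
have [W _ dW] := antiderivative_ex cw.
have [Z _ dZ] := antiderivative_ex cz.
have dK : antiderivative (fun x => k * (U (x + h) + W (x - h) - 2 * Z x))
    (fun x => f x * (k * sdiff h phi x)).
  apply: (antider_eq (antiderZ k (antiderB (antiderD (antider_shift h dU)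
    (antider_shift (- h) dW)) (antiderZ 2 dZ)))) => x.
  by rewrite /u /w /z /sdiff addrK subrK; ring.
rewrite (FTC_antiderivative (ctsM cf c2) dK); last by lra.
rewrite lee_fin -mulrBr -ler_pdivlMl// invrK => Hint.
have dY' : antiderivative (fun x => U x + W x - 2 * Z x) (fun x => phi x * sdiff h f x).
  apply: (antider_eq (antiderB (antiderD dU dW) (antiderZ 2 dZ))) => x.
  by rewrite /u /w /z /sdiff; ring.
have -> : Y (A + h) - Y (- (A + h)) = (U (A + h) + W (A + h) - 2 * Z (A + h))
    - (U (- (A + h)) + W (- (A + h)) - 2 * Z (- (A + h))).
  apply: (@der_unique _ Y (fun x => U x + W x - 2 * Z x)
    (fun x => phi x * sdiff h f x)) => [|y _|y _]; [lra|exact: dY|exact: dY'].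
(* translating by [h] moves the end points only through regions where [phi] vanishes *)
have cst Q q a b : antiderivative Q q -> (forall x, phi x = 0 -> q x = 0) -> a <= b ->
    (A <= a) || (b <= - A) -> Q b = Q a.
  move=> dQ q0 ab Aab; apply: (der_eq0 ab (fun y _ => dQ y)) => y yab.
  apply/q0/phi0; have := ler_norm y; have := ler_norm (- y); rewrite normrN.
  by case/orP: Aab; lra.
move: Hint; rewrite [V * _]mulrC.
have phi00 g x : phi x = 0 -> g x * phi x = 0 by move=> ->; rewrite mulr0.
rewrite (cst _ _ (A + h) (A + h + h) dU (phi00 _)); [|lra|apply/orP; left; lra].
rewrite (cst _ _ (- (A + h)) (- (A + h) + h) dU (phi00 _)); [|lra|apply/orP; right; lra].
rewrite -(cst _ _ (A + h - h) (A + h) dW (phi00 _)); [|lra|apply/orP; left; lra].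
rewrite -(cst _ _ (- (A + h) - h) (- (A + h)) dW (phi00 _)); [|lra|apply/orP; right; lra].
by [].
Qed.

(** Duality with [phi = zeta v / (|v| + e)], where [v] is the second difference
and [zeta] a cutoff: it satisfies [|phi| <= 1] and [phi v >= |v| - e] where
[zeta = 1]. *)
Lemma tested_sdiff_L1 f V h (P : R -> R) a b : continuous f -> tested f V -> 0 < h ->
  antiderivative P (fun x => `|sdiff h f x|) -> a <= b -> P b - P a <= V * h ^+ 2.
Proof.
move=> cf fV h0 dP ab; apply: (@le_linear_eps _ _ _ (b - a) 1) => // e /andP[e0 _].
pose N := `|a| + `|b|.
have Na : - N <= a by have := ler_norm (- a); have := normr_ge0 b; rewrite /N normrN; lra.
have Nb : b <= N by have := ler_norm b; have := normr_ge0 a; rewrite /N; lra.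
pose zeta (x : R) : R := Num.min 1 (Num.max 0 (N + 1 - `|x|)).
have cv := cts_sdiff (h := h) cf.
have czeta : continuous zeta.
  have c1 : continuous (fun x : R => N + 1 - `|x|) := ctsB (cts_cst (N + 1)) (cts_norm cts_id).
  have c0 : continuous (fun x : R => Num.max 0 (N + 1 - `|x|)).
    by move=> x; exact: (continuous_max (cts_cst 0 x) (c1 x)).
  by move=> x; exact: (continuous_min (cts_cst 1 x) (c0 x)).
have zeta01 x : 0 <= zeta x <= 1 by rewrite /zeta le_min ler01 le_max lexx ge_min lexx.
pose s x := (`|sdiff h f x| + e)^-1.
have s0 x : 0 < `|sdiff h f x| + e by rewrite ltr_wpDl.
pose phi x := zeta x * (sdiff h f x * s x).
have cphi : continuous phi.
  apply: (ctsM czeta (ctsM cv (cts_inv _ (ctsD (cts_norm cv) (cts_cst e))))).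
  by move=> x; rewrite gt_eqF.
have phi1 x : `|phi x| <= 1.
  rewrite /phi !normrM (ger0_norm (x := zeta x)); last by case/andP: (zeta01 x).
  rewrite (gtr0_norm (x := s x)) ?invr_gt0//.
  apply: mulr_ile1; rewrite ?mulr_ge0 ?invr_ge0 ?(ltW (s0 x))//;
    try by case/andP: (zeta01 x).
  by rewrite /s ler_pdivrMr// mul1r lerDl ltW.
have phi0 x : N + 1 <= `|x| -> phi x = 0.
  by move=> Nx; rewrite /phi /zeta max_l ?min_r ?mul0r// subr_le0.
have [Y _ dY] := antiderivative_ex (ctsM cphi cv).
have N0 : 0 <= N by rewrite addr_ge0.
have := @tested_sdiff f phi V h (N + 1) Y cf fV h0 cphi phi1 phi0 dY.
have phivE x : phi x * sdiff h f x = zeta x * (`|sdiff h f x| ^+ 2 * s x).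
  by rewrite real_normK ?num_real// /phi; ring.
have phiv0 x : 0 <= phi x * sdiff h f x.
  rewrite phivE; apply: mulr_ge0; first by case/andP: (zeta01 x).
  by apply: mulr_ge0; rewrite ?sqr_ge0// invr_ge0 ltW.
have mono x y : x <= y -> Y x <= Y y.
  by move=> xy; apply: (der_ge0 xy (fun z _ => dY z)) => z _; exact: phiv0.
have m1 : Y b <= Y (N + 1 + h) by apply: mono; lra.
have m2 : Y (- (N + 1 + h)) <= Y a by apply: mono; lra.
have dPe : antiderivative (fun x => P x - e * x) (fun x => `|sdiff h f x| - e).
  by apply: (antider_eq (antiderB dP (antiderZ e (@der_id R)))) => x; rewrite mulr1.
have : P b - e * b - (P a - e * a) <= Y b - Y a.
  apply: (der_le ab (fun y _ => dPe y) (fun y _ => dY y)) => y yab.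
  rewrite phivE /zeta min_l; last first.
    rewrite le_max; apply/orP; right.
    have : `|y| <= N by rewrite ler_norml; lra.
    lra.
  rewrite mul1r ler_pdivlMr//.
  by rewrite -subr_sqr gerBl sqr_ge0.
move=> m3 m4; have := m4 (addr_ge0 N0 ler01); lra.
Qed.

End SecondDifferenceL1.

(** * Means of a convex function, and dilations *)

Section Mean.
Context {R : realType}.
Implicit Types (F W P p : R -> R) (V x y k th : R).

(** With [W2] a primitive of the even function [W], this is the mean of [W] over
the interval between [0] and [x]; at [0] it is [0] since [0^-1 = 0]. *)
Definition mean (W2 : R -> R) x : R := W2 `|x| / `|x|.

(** Both inequalities between [W2 y / y] and [W2 x / x] are proved by comparing
[W2] with [y c] and with [y (c + V (y - x))] where [c = W2 x / x]: a quotient need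
not be differentiated, and [x = 0] is not special. *)
Lemma mean_lipschitz (W2 W P : R -> R) V : antiderivative W2 W -> antiderivative W P ->
  W2 0 = 0 -> W 0 = 0 -> (forall x, 0 <= x -> 0 <= P x <= V) ->
  forall x y, `|mean W2 x - mean W2 y| <= V * `|x - y|.
Proof.
move=> dW2 dW W20 W0 PV.
have V0 : 0 <= V by have := PV 0 (lexx _); lra.
have Wmono x y : 0 <= x -> x <= y -> W x <= W y.
  move=> x0 xy; apply: (der_ge0 xy (fun z _ => dW z)) => z zI.
  by have := PV z; lra.
have Wge0 x : 0 <= x -> 0 <= W x by move=> x0; rewrite -W0; exact: Wmono.
have WV x : 0 <= x -> W x <= V * x.
  move=> x0; have := @der_le _ W P (fun y => V * y) (fun=> V * 1) 0 x x0
    (fun z _ => dW z) (fun z _ => derZ V (der_id z)).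
  rewrite W0 mulr0 !subr0; apply => z zI; rewrite mulr1; have := PV z; lra.
have W2ge0 x : 0 <= x -> 0 <= W2 x.
  move=> x0; rewrite -W20; apply: (der_ge0 x0 (fun z _ => dW2 z)) => z zI.
  by apply: Wge0; lra.
have key x y : 0 <= x -> x <= y -> `|mean W2 y - mean W2 x| <= V * (y - x).
  rewrite /mean => x0; rewrite le_eqVlt => /predU1P[<-|xy].
    by rewrite !subrr normr0 mulr0.
  rewrite (ger0_norm x0) (ger0_norm (x := y)); last lra.
  set c := W2 x / x.
  have c0 : 0 <= c by rewrite divr_ge0// W2ge0.
  have xc : W2 x = x * c.
    rewrite /c mulrCA; move: x0; rewrite le_eqVlt => /predU1P[<-|x0'].
      by rewrite W20 mul0r.
    by rewrite divff ?mulr1// gt_eqF.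
  have y0 : 0 < y by lra.
  have cW z : x <= z -> c <= W z.
    move=> xz; rewrite /c; move: (x0); rewrite le_eqVlt => /predU1P[x0'|x0'].
      by rewrite -x0' W20 mul0r Wge0//; lra.
    have [d dI E] := der_mvt x0 (fun z _ => dW2 z).
    rewrite ler_pdivrMr//; move: E; rewrite W20 !subr0 => ->.
    by apply: ler_wpM2r => //; apply: Wmono; lra.
  have up : W2 y - y * (c + V * (y - x)) <= W2 x - x * (c + V * (x - x)).
    have dH (z : R) : is_derive z 1 (fun y => y * (c + V * (y - x)) - W2 y)
        (c + V * (z - x) + z * V - W z).
      apply: is_derive_eq (derB (derM (der_id z) (derD (der_cst c z)
        (derZ V (derB (der_id z) (der_cst x z))))) (dW2 z)) _; ring.
    have := @der_ge0 _ _ (fun z => c + V * (z - x) + z * V - W z) x y (ltW xy) (fun z _ => dH z).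
    suff H : forall z, x <= z <= y -> 0 <= c + V * (z - x) + z * V - W z.
      by move=> /(_ H); lra.
    move=> z zI; have := WV z; have : 0 <= V * (z - x) by rewrite mulr_ge0; lra.
    lra.
  have down : W2 x - x * c <= W2 y - y * c.
    have dH (z : R) : is_derive z 1 (fun y => W2 y - y * c) (W z - c).
      by apply: is_derive_eq (derB (dW2 z) (derM (der_id z) (der_cst c z))) _; ring.
    apply: (der_ge0 (ltW xy) (fun z _ => dH z)) => z zI.
    by rewrite subr_ge0 cW//; lra.
  rewrite ler_norml; apply/andP; split.
    have : c <= W2 y / y by rewrite ler_pdivlMr//; lra.
    have : 0 <= V * (y - x) by rewrite mulr_ge0; lra.
    lra.
  by rewrite lerBlDr ler_pdivrMr//; lra.
move=> x y; have -> : mean W2 x - mean W2 y = mean W2 `|x| - mean W2 `|y|.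
  by rewrite /mean !normr_id.
apply: (@le_trans _ _ (V * `| `|x| - `|y| |)).
  have [xy|/ltW yx] := leP `|x| `|y|.
    by rewrite distrC (ler0_norm (x := `|x| - `|y|)) ?opprB ?key// subr_le0.
  by rewrite (ger0_norm (x := `|x| - `|y|)) ?key// subr_ge0.
by rewrite ler_wpM2l// ler_dist_dist.
Qed.

(** If [F' = f] then [F (l y) / l] is the integral of [f (l z)] for [z] from [0] to
[y], so this is the integral of the second differences of [f] with step [th z]
at [z]. *)
Definition dil (F : R -> R) th y : R :=
  F ((1 + th) * y) / (1 + th) + F ((1 - th) * y) / (1 - th) - 2 * F y.

Lemma der_dil F f th : 0 < th < 1 -> antiderivative F f ->
  antiderivative (dil F th) (fun y => sdiff (th * y) f y).
Proof.
move=> th01 dF.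
have sc c : c != 0 -> antiderivative (fun y => F (c * y) / c) (fun y => f (c * y)).
  move=> c0 y; have dc : is_derive y 1 (fun y => F (c * y)) (c * f (c * y)).
    have /der_affine : is_derive (c * y + 0) 1 F (f (c * y)) by rewrite addr0.
    by under [X in is_derive _ _ X]funext do rewrite addr0.
  apply: is_derive_eq (derM dc (der_cst c^-1 y)) _.
  by rewrite mulr0 add0r mulKf.
apply: (antider_eq (antiderB (antiderD (sc (1 + th) _) (sc (1 - th) _)) (antiderZ 2 dF))).
- lra.
- lra.
- by move=> y; rewrite /sdiff mulrDl mulrBl !mul1r.
Qed.

(** The mean of [W] over [[0, l x]] is the mean of [W (l y)] over the fixed
interval [[0, x]]. *)
Lemma dil_mean (W2 : R -> R) x k : 0 < k < x -> sdiff k (mean W2) x = dil W2 (k / x) x / x.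
Proof.
move=> kx; have x0 : 0 < x by lra.
have xN0 : x != 0 by rewrite gt_eqF.
rewrite /sdiff /mean (gtr0_norm x0) (gtr0_norm (x := x + k)); last lra.
rewrite (gtr0_norm (x := x - k)); last lra.
rewrite /dil (_ : (1 + k / x) * x = x + k); last by field.
rewrite (_ : (1 - k / x) * x = x - k); last by field.
rewrite (_ : 1 + k / x = (x + k) / x); last by field.
rewrite (_ : 1 - k / x = (x - k) / x); last by field.
by field; rewrite xN0 !gt_eqF//; lra.
Qed.

Lemma dil_convex (W2 : R -> R) W P p th : 0 < th < 1 -> antiderivative W2 W ->
  antiderivative W P -> antiderivative P p -> (forall y, 0 <= p y) ->
  forall y z, 0 <= y -> y <= z -> dil W2 th y <= dil W2 th z.
Proof.
move=> th01 dW2 dW dP p0 y z y0 yz.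
apply: (der_ge0 yz (fun u _ => der_dil th01 dW2 u)) => u uI.
by apply: (sdiff_ge0 _ dW dP) => //; rewrite mulr_ge0//; lra.
Qed.

Lemma dil0 F th : F 0 = 0 -> dil F th 0 = 0.
Proof. by move=> F0; rewrite /dil !mulr0 F0 !mul0r mulr0 subr0 addr0. Qed.

End Mean.

(** * Comparison of averages with dilated averages *)

Section Regularization.
Context {R : realType}.
Implicit Types (f F J : R -> R) (V L h k x t : R).

(** Subtracting the constant [f x] from [f] leaves a function bounded by [L h] on
the window of the average. *)
Lemma steklov_close f F (F2 : R -> R) L h x :
  (forall x y, `|f x - f y| <= L * `|x - y|) -> 0 < h ->
  antiderivative F f -> antiderivative F2 F ->
  `|(h ^+ 2)^-1 * sdiff h F2 x - f x| <= L * h.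
Proof.
move=> fL h0 dF dF2.
have h20 : 0 < h ^+ 2 by rewrite exprn_gt0.
have L0 : 0 <= L by have := fL 1 0; have := normr_ge0 (f 1 - f 0); rewrite subr0 normr1; lra.
have dl : antiderivative (fun y => F y - f x * y) (fun y => f y - f x).
  by apply: (antider_eq (antiderB dF (antiderZ (f x) (@der_id R)))) => y; rewrite mulr1.
have dl2 : antiderivative (fun y => F2 y - f x / 2 * (y * y)) (fun y => F y - f x * y).
  apply: (antider_eq (antiderB dF2 (antiderZ (f x / 2)
    (fun y => derM (der_id y) (der_id y))))) => y; lra.
rewrite -(ler_pM2l h20) -{1}(gtr0_norm h20) -normrM.
have <- : sdiff h (fun y => F2 y - f x / 2 * (y * y)) x =
    h ^+ 2 * ((h ^+ 2)^-1 * sdiff h F2 x - f x).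
  by rewrite /sdiff; field; rewrite gt_eqF.
rewrite [leRHS]mulrC; apply: (sdiff_norm_le (ltW h0) dl2 dl) => y yI.
by apply: le_trans (fL y x) _; rewrite ler_wpM2l// ler_norml; lra.
Qed.

(** [J] is the mean of the convex [W] with [W'' = |f_h''|].  The two dilated
integrals over [[0, x]] and [[0, t]] add up to the integral over [[-t, x]]; each is
at least minus that of [W] since [f_h + W] is convex, and the one for [W]
increases with the length of the interval.  Replacing [f] by [f_h] in the four
averages costs [4 L h]. *)
Lemma regularized_comparison f F V L h : continuous f ->
  (forall x y, `|f x - f y| <= L * `|x - y|) -> tested f V ->
  antiderivative F f -> F 0 = 0 -> 0 < h ->
  exists J : R -> R,
  [/\ forall x y, `|J x - J y| <= V * `|x - y|,
      forall k x, 0 < k < x -> 0 <= sdiff k J x &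
      forall k x t, 0 < k < x -> 0 <= t <= x ->
        - 2 * sdiff k J x - 4 * (L * h) <=
        (F (x + k) + F ((1 + k / x) * t)) / (x + k + (1 + k / x) * t) +
        (F (x - k) + F ((1 - k / x) * t)) / (x - k + (1 - k / x) * t) -
        2 * ((F x + F t) / (x + t))].
Proof.
move=> cf fL fV dF F0 h0.
have [F2 _ dF2] := antiderivative_ex (der_continuous dF).
have h20 : 0 < h ^+ 2 by rewrite exprn_gt0.
pose c := (h ^+ 2)^-1; have c0 : 0 < c by rewrite invr_gt0.
pose fh x := c * sdiff h F2 x.
pose v x := c * sdiff h f x.
have d1 : antiderivative fh (fun x => c * sdiff h F x) := antiderZ c (der_sdiff h dF2).
have d2 : antiderivative (fun x => c * sdiff h F x) v := antiderZ c (der_sdiff h dF).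
have cv : continuous v := ctsZ c (cts_sdiff (h := h) cf).
have [Fh Fh0 dFh] := antiderivative_ex (der_continuous d1).
have [P P0 dP] := antiderivative_ex (cts_norm cv).
have [W W0 dW] := antiderivative_ex (der_continuous dP).
have [W2 W20 dW2] := antiderivative_ex (der_continuous dW).
have PV x : 0 <= x -> 0 <= P x <= V.
  move=> x0; apply/andP; split.
    by rewrite -P0; apply: (der_ge0 x0 (fun y _ => dP y)) => y _.
  have dP' : antiderivative (fun x => h ^+ 2 * P x) (fun x => `|sdiff h f x|).
    apply: (antider_eq (antiderZ (h ^+ 2) dP)) => y.
    by rewrite /v normrM gtr0_norm// mulrA mulfV ?mul1r// gt_eqF.
  have := tested_sdiff_L1 cf fV h0 dP' x0.
  by rewrite P0 mulr0 subr0 mulrC ler_pM2r.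
have fhf x : `|fh x - f x| <= L * h := steklov_close x fL h0 dF dF2.
have FhF x : 0 <= x -> `|Fh x - F x| <= L * h * x.
  move=> x0; rewrite ler_norml.
  have l y : fh y - L * h <= f y by have := fhf y; rewrite ler_norml; lra.
  have l' y : f y <= fh y + L * h by have := fhf y; rewrite ler_norml; lra.
  have dl (s : R) : antiderivative (fun y => Fh y + s * y) (fun y => fh y + s).
    by apply: (antider_eq (antiderD dFh (antiderZ s (@der_id R)))) => y; rewrite mulr1.
  have := @der_le _ _ _ F f 0 x x0 (fun y _ => dl (- (L * h)) y) (fun y _ => dF y) (fun y _ => l y).
  have := @der_le _ F f _ _ 0 x x0 (fun y _ => dF y) (fun y _ => dl (L * h) y) (fun y _ => l' y).
  rewrite F0 Fh0 !mulr0; lra.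
have J2 k x : 0 < k < x -> 0 < k / x < 1.
  by move=> kx; rewrite divr_gt0 ?ltr_pdivrMr; lra.
exists (mean W2); split.
- exact: mean_lipschitz dW2 dW W20 W0 PV.
- move=> k x kx; rewrite dil_mean//; apply: divr_ge0; last lra.
  rewrite -(dil0 (k / x) W20).
  by apply: (dil_convex (J2 _ _ kx) dW2 dW dP) => //; lra.
move=> k x t kx tx; rewrite dil_mean//.
have x0 : 0 < x by lra.
have := J2 _ _ kx; set th := k / x => th01.
have -> : x + k = (1 + th) * x by rewrite /th; field; rewrite gt_eqF.
have -> : x - k = (1 - th) * x by rewrite /th; field; rewrite gt_eqF.
have Wmono := @dil_convex _ W2 W P _ th th01 dW2 dW dP (fun y => normr_ge0 (v y)).
have dQ : antiderivative (fun y => Fh y + W2 y) (fun y => fh y + W y) := antiderD dFh dW2.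
have dQ1 := antiderD d1 dW; have dQ2 := antiderD d2 dP.
have vv y : 0 <= v y + `|v y| by rewrite -lerBlDl sub0r -normrN ler_norm.
have Qmono := dil_convex th01 dQ dQ1 dQ2 vv.
have dilD y : dil (fun y => Fh y + W2 y) th y = dil Fh th y + dil W2 th y.
  by rewrite /dil; ring.
have low y : 0 <= y <= x -> - dil W2 th x <= dil Fh th y.
  move=> yx; have := Qmono 0 y; have := Wmono y x.
  rewrite !dilD (dil0 th W20) (dil0 th Fh0); lra.
have Wx0 : 0 <= dil W2 th x by rewrite -(dil0 th W20); apply: Wmono; lra.
have avg s : 0 < s -> (Fh (s * x) + Fh (s * t)) / (s * x + s * t) - L * h <=
    (F (s * x) + F (s * t)) / (s * x + s * t) <=
    (Fh (s * x) + Fh (s * t)) / (s * x + s * t) + L * h.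
  move=> s0; have sx : 0 < s * x by rewrite mulr_gt0.
  have st : 0 <= s * t by rewrite mulr_ge0; lra.
  have d0 : 0 < s * x + s * t by lra.
  have := FhF _ st; have := FhF _ (ltW sx); rewrite !ler_norml => A1 A2.
  rewrite lerBlDr -[L * h in X in _ && X](mulfK (x := s * x + s * t)) ?gt_eqF//.
  rewrite -[L * h in X in X && _](mulfK (x := s * x + s * t)) ?gt_eqF//.
  rewrite -!mulrDl !ler_pM2r ?invr_gt0//; lra.
have th1 : 0 < 1 + th by lra.
have th2 : 0 < 1 - th by lra.
have A1 := avg 1 ltr01; have A2 := avg _ th2; have A3 := avg _ th1.
rewrite !mul1r in A1.
suff : - 2 * (dil W2 th x / x) <=
    (Fh ((1 + th) * x) + Fh ((1 + th) * t)) / ((1 + th) * x + (1 + th) * t) +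
    (Fh ((1 - th) * x) + Fh ((1 - th) * t)) / ((1 - th) * x + (1 - th) * t) -
    2 * ((Fh x + Fh t) / (x + t)) by lra.
have -> : (Fh ((1 + th) * x) + Fh ((1 + th) * t)) / ((1 + th) * x + (1 + th) * t) +
    (Fh ((1 - th) * x) + Fh ((1 - th) * t)) / ((1 - th) * x + (1 - th) * t) -
    2 * ((Fh x + Fh t) / (x + t)) = (dil Fh th x + dil Fh th t) / (x + t).
  by rewrite /dil; field; rewrite -!mulrDr ?mulf_eq0 ?negb_or; lra.
rewrite ler_pdivlMr; last lra.
apply: (@le_trans _ _ (- 2 * dil W2 th x)); last by have := low x; have := low t; lra.
rewrite -mulrA ler_nM2l; last lra.
by rewrite mulrAC ler_pdivlMr// ler_wpM2l//; lra.
Qed.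

(** This says that [g + 2 J] is convex on the half-line for some convex [J] with
Lipschitz constant [V], up to an error that can be made small.  The function [J]
depends on the error, but its Lipschitz constant does not. *)
Definition concavity_controlled (g : R -> R) V L := forall h, 0 < h ->
  exists J : R -> R,
  [/\ forall x y, `|J x - J y| <= V * `|x - y|,
      forall k x, 0 < k < x -> 0 <= sdiff k J x &
      forall k x, 0 < k < x -> - 2 * sdiff k J x - 4 * (L * h) <= sdiff k g x].

End Regularization.

(** * The maximal function of an even, radially decreasing Lipschitz function *)

Section MaximalFunction.
Context {R : realType}.
Variables (f F : R -> R) (L : R).
Hypothesis fL : forall x y, `|f x - f y| <= L * `|x - y|.
Hypothesis f_even : forall x, f (- x) = f x.
Hypothesis f_dec : forall x y, `|x| <= `|y| -> f y <= f x.
Hypothesis dF : antiderivative F f.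
Hypothesis F0 : F 0 = 0.

Lemma odd_primitive x : F (- x) = - F x.
Proof.
have dS : antiderivative (fun y => F y + F (- y)) (fun y => f y + - f (- y)).
  exact: antiderD dF (antider_opp dF).
suff : F x + F (- x) = 0 by lra.
have S0 : F 0 + F (- 0) = 0 by rewrite oppr0 F0 addr0.
have [x0|/ltW x0] := leP 0 x.
  by rewrite (der_eq0 x0 (fun y _ => dS y))// => y _; rewrite f_even subrr.
by rewrite -(der_eq0 x0 (fun y _ => dS y))// => y _; rewrite f_even subrr.
Qed.

Lemma primitive_le a b v : a <= b -> (forall y, a <= y <= b -> f y <= v) ->
  F b - F a <= v * (b - a).
Proof.
move=> ab fv; rewrite mulrBr.
by apply: (der_le ab (fun y _ => dF y) (fun y _ => derZ v (der_id y))) => y yab; rewrite mulr1 fv.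
Qed.

Lemma primitive_ge a b v : a <= b -> (forall y, a <= y <= b -> v <= f y) ->
  v * (b - a) <= F b - F a.
Proof.
move=> ab fv; rewrite mulrBr.
by apply: (der_le ab (fun y _ => derZ v (der_id y)) (fun y _ => dF y)) => y yab; rewrite mulr1 fv.
Qed.

Lemma maximal_real : exists g : R -> R,
  [/\ forall x, maximal f x = (g x)%:E,
      forall a x b, a < x < b -> (F b - F a) / (b - a) <= g x &
      forall x m, (forall a b, a < x < b -> (F b - F a) / (b - a) <= m) -> g x <= m].
Proof.
have avgE a b : a < b -> average f a b = ((F b - F a) / (b - a))%:E.
  move=> ab; rewrite /average (FTC_antiderivative (lipschitz_cts fL) dF) ?ltW//.
  by rewrite -EFinM mulrC.
pose S x := [set average f p.1 p.2 | p in [set p : R * R | p.1 < x < p.2]].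
have Sub x m : (forall a b, a < x < b -> (F b - F a) / (b - a) <= m) ->
    (ereal_sup (S x) <= m%:E)%E.
  move=> H; apply: ge_ereal_sup => _ [[a b] /= abx <-].
  by rewrite avgE ?lee_fin ?H//; lra.
have Slb x a b : a < x < b -> (((F b - F a) / (b - a))%:E <= ereal_sup (S x))%E.
  move=> abx; apply: ereal_sup_ubound; exists (a, b) => //=.
  by rewrite avgE//; lra.
have fin x : maximal f x \is a fin_num.
  have I : x - 1 < x < x + 1 by lra.
  rewrite fin_numE; apply/andP; split; apply/eqP => E.
    by have := Slb x _ _ I; rewrite -/(maximal f x) E.
  have := Sub x (f 0); rewrite -/(maximal f x) E => H.
  have : (+oo <= (f 0)%:E)%E; last by [].
  apply: H => a b abx; rewrite ler_pdivrMr; last lra.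
  by apply: primitive_le => [|y _]; [lra|apply: f_dec; rewrite normr0].
exists (fun x => fine (maximal f x)); split => [x|a x b abx|x m H].
- by rewrite fineK.
- by rewrite -lee_fin fineK//; exact: Slb.
- by rewrite -lee_fin fineK//; exact: Sub.
Qed.

(** By [maximal_real], the two hypotheses below characterize the maximal function
as a supremum of averages. *)
Variable g : R -> R.
Hypothesis g_ge : forall a x b, a < x < b -> (F b - F a) / (b - a) <= g x.
Hypothesis g_le : forall x m,
  (forall a b, a < x < b -> (F b - F a) / (b - a) <= m) -> g x <= m.

Lemma maximal_even x : g (- x) = g x.
Proof.
suff H y : g (- y) <= g y by apply/le_anti; rewrite H -{1}(opprK x) H.
apply: g_le => a b abx.
have := @g_ge (- b) y (- a); rewrite !odd_primitive.
have -> : (- F a - - F b) / (- a - - b) = (F b - F a) / (b - a).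
  by rewrite !opprK addrC [in X in _ / X]addrC.
by apply; lra.
Qed.

(** Translate the competing intervals from [u] to [v]. *)
Lemma maximal_lipschitz x y : `|g x - g y| <= L * `|x - y|.
Proof.
suff H u v : g u <= g v + L * `|u - v|.
  have := H x y; have := H y x; rewrite distrC => H1 H2.
  by rewrite ler_norml; lra.
apply: g_le => a b abu; set s := v - u.
have ab : 0 < b - a by lra.
have := @g_ge (a + s) v (b + s); rewrite opprD addrACA subrr addr0 => gv.
suff H : (F b - F a) / (b - a) <= (F (b + s) - F (a + s)) / (b - a) + L * `|u - v|.
  by apply: le_trans H _; rewrite lerD2r gv// /s; lra.
rewrite ler_pdivrMr// mulrDl divfK ?gt_eqF//.
have ds : antiderivative (fun y => F (y + s) + L * `|u - v| * y)
    (fun y => f (y + s) + L * `|u - v|).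
  apply: (antider_eq (antiderD (antider_shift s dF) (antiderZ (L * `|u - v|) (@der_id R)))) => z.
  by rewrite mulr1.
have ab' : a <= b by lra.
have := der_le ab' (fun y _ => dF y) (fun y _ => ds y).
suff H : forall z, a <= z <= b -> f z <= f (z + s) + L * `|u - v|.
  by move=> /(_ H); lra.
move=> z _; have := fL z (z + s); have -> : z - (z + s) = u - v by rewrite /s; ring.
by rewrite ler_norml; lra.
Qed.

(** The interval [[-t, x]] has [x] as an end point, hence competes only at points
left of [x]; the Lipschitz bound for [g] reaches [x] itself. *)
Lemma maximal_ge x t : 0 < x -> 0 <= t -> (F x + F t) / (x + t) <= g x.
Proof.
move=> x0 t0; apply: (@le_linear_eps _ _ _ L x) => // e /andP[e0 ex].
have := @g_ge (- t) (x - e) x; rewrite odd_primitive !opprK => H.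
have := maximal_lipschitz (x - e) x.
rewrite (_ : x - e - x = - e); last by ring.
rewrite normrN (gtr0_norm e0) ler_norml.
have : (F x + F t) / (x + t) <= g (x - e) by apply: H; lra.
lra.
Qed.

(** Compared with the average over [[-t, x]] for the right [t], a general interval
around [x] only adds points where [f] is at most [f x], outside [[-x, x]], or omits
points of [[0, a]] where [f] is at least [f a], if [0 < a]. *)
Lemma maximal_le x m : 0 < x ->
  (forall t, 0 <= t <= x -> (F x + F t) / (x + t) <= m) -> g x <= m.
Proof.
move=> x0 H.
have Hm t : 0 <= t <= x -> F x + F t <= m * (x + t).
  by move=> tx; rewrite -ler_pdivrMr ?H//; lra.
have Fx : f x * x <= F x.
  have := @primitive_ge 0 x (f x) (ltW x0); rewrite F0 !subr0; apply => y yx.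
  by apply: f_dec; rewrite !ger0_norm//; lra.
have mx : F x <= m * x by have := Hm x; lra.
have fm : f x <= m by rewrite -(ler_pM2r x0); lra.
apply: g_le => a b abx; rewrite ler_pdivrMr; last lra.
have Fb : F b - F x <= m * (b - x).
  apply: primitive_le => [|y yI]; first lra.
  by apply: le_trans fm; apply: f_dec; rewrite !ger0_norm//; lra.
suff : F x - F a <= m * (x - a) by lra.
have [a0|a0] := leP a 0.
  have [xa|xa] := leP (- x) a.
    by have := Hm (- a); rewrite odd_primitive; lra.
  have : F (- x) - F a <= m * (- x - a).
    apply: primitive_le => [|y yI]; first lra.
    apply: le_trans fm; apply: f_dec; rewrite gtr0_norm// ler0_norm; lra.
  have := Hm x; rewrite odd_primitive; lra.
have Fa : f a * a <= F a.
  have := @primitive_ge 0 a (f a) (ltW a0); rewrite F0 !subr0; apply => y yx.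
  by apply: f_dec; rewrite !ger0_norm//; lra.
have Fxa : F x - F a <= f a * (x - a).
  apply: primitive_le => [|y yI]; first lra.
  by apply: f_dec; rewrite !ger0_norm//; lra.
rewrite -(ler_pM2r x0).
have xa0 : 0 <= x - a by lra.
have s1 : (F x - F a) * a <= f a * (x - a) * a by apply: ler_wpM2r => //; lra.
have s2 : f a * a * (x - a) <= F a * (x - a) by exact: ler_wpM2r.
have s3 : F x * (x - a) <= m * x * (x - a) by exact: ler_wpM2r.
lra.
Qed.

(** A nearly optimal [[-t, x]] is dilated by [1 + k / x] and by [1 - k / x] into
competitors at [x + k] and at [x - k]. *)
Lemma maximal_sdiff V : tested f V -> concavity_controlled g V L.
Proof.
move=> fV h h0.
have [J [JL J0 HJ]] := regularized_comparison (lipschitz_cts fL) fL fV dF F0 h0.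
exists J; split => // k x kx.
suff : g x <= (g (x + k) + g (x - k) + 2 * sdiff k J x + 4 * (L * h)) / 2.
  by move=> H; rewrite [leRHS]/sdiff; lra.
have th0 : 0 < k / x < 1 by rewrite divr_gt0 ?ltr_pdivrMr; lra.
apply: maximal_le => [|t tx]; first lra.
have := HJ k x t kx tx.
have := @maximal_ge (x + k) ((1 + k / x) * t).
have := @maximal_ge (x - k) ((1 - k / x) * t).
have t1 : 0 <= (1 + k / x) * t by rewrite mulr_ge0; lra.
have t2 : 0 <= (1 - k / x) * t by rewrite mulr_ge0; lra.
move=> H1 H2; have := H1 _ t2; have := H2 _ t1.
have xk1 : 0 < x - k by lra.
have xk2 : 0 < x + k by lra.
move=> /(_ xk2) A2 /(_ xk1) A1; lra.
Qed.

End MaximalFunction.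

(** * From second differences to the variation *)

Section Variation.
Context {R : realType}.
Implicit Types (U g J Y : R -> R) (V L B h k x y : R).

(** The integral of a second difference of [U] is a second difference of a
primitive [I] of [U], namely an increment of [I x - I (x - k)]. *)
Lemma sdiff_telescope U Y L k a b :
  (forall x y, `|U x - U y| <= L * `|x - y|) -> 0 < k ->
  antiderivative Y (sdiff k U) -> a <= b -> Y b - Y a <= 2 * L * k ^+ 2.
Proof.
move=> UL k0 dY ab.
have [I _ dI] := antiderivative_ex (lipschitz_cts UL).
have dD : antiderivative (fun x => I x - I (x - k)) (fun x => U x - U (x - k)).
  exact: antiderB dI (antider_shift (- k) dI).
have ID x : `|sdiff k I x| <= L * k ^+ 2.
  have xk : x <= x + k by lra.
  have [c cI E] := der_mvt xk (fun y _ => dD y).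
  have -> : sdiff k I x = (U c - U (c - k)) * k.
    rewrite (_ : x + k - x = k) in E; last by ring.
    by rewrite -E addrK /sdiff; ring.
  rewrite normrM (gtr0_norm k0) expr2 mulrA ler_pM2r//.
  by apply: le_trans (UL _ _) _; rewrite opprB addrC subrK (gtr0_norm k0).
have -> : Y b - Y a = sdiff k I b - sdiff k I a.
  exact: (der_unique ab (fun y _ => dY y) (fun y _ => der_sdiff k dI y)).
have := ID b; have := ID a; rewrite !ler_norml; lra.
Qed.

(** If [D] denotes second differences, then [D g >= - 2 D J] and [D J >= 0] give
[|D g| <= D (g + 4 J)]. *)
Lemma sdiff_side_L1 g V L k B Y : 0 < k -> 2 * k <= B ->
  (forall x y, `|g x - g y| <= L * `|x - y|) ->
  concavity_controlled g V L ->
  antiderivative Y (fun x => `|sdiff k g x|) ->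
  Y B - Y (2 * k) <= 2 * (L + 4 * V) * k ^+ 2.
Proof.
move=> k0 kB gL HJ dY.
apply: (@le_linear_eps _ _ _ (8 * L * (B - 2 * k)) 1) => // h /andP[h0 _].
have [J [JL J0 Jg]] := HJ h h0.
pose U x := g x + 4 * J x.
have UL x y : `|U x - U y| <= (L + 4 * V) * `|x - y|.
  have -> : U x - U y = (g x - g y) + 4 * (J x - J y) by rewrite /U; ring.
  apply: le_trans (ler_normD _ _) _; rewrite [leRHS]mulrDl; apply: lerD => //.
  by rewrite normrM (ger0_norm (x := 4))// -mulrA ler_pM2l.
have [Z _ dZ] := antiderivative_ex (cts_sdiff (h := k) (lipschitz_cts UL)).
have dZ' : antiderivative (fun x => Z x + 8 * (L * h) * x) (fun x => sdiff k U x + 8 * (L * h)).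
  by apply: (antider_eq (antiderD dZ (antiderZ _ (@der_id R)))) => x; rewrite mulr1.
have := sdiff_telescope UL k0 dZ kB.
have := der_le kB (fun x _ => dY x) (fun x _ => dZ' x).
suff H : forall x, 2 * k <= x <= B -> `|sdiff k g x| <= sdiff k U x + 8 * (L * h).
  by move=> /(_ H); lra.
have Lh : 0 <= L * h.
  apply: mulr_ge0; last exact: ltW.
  by have := gL 1 0; have := normr_ge0 (g 1 - g 0); rewrite subr0 normr1; lra.
move=> x xI; have kx : 0 < k < x by lra.
have -> : sdiff k U x = sdiff k g x + 4 * sdiff k J x by rewrite /U /sdiff; ring.
by rewrite ler_norml; have := J0 k x kx; have := Jg k x kx; lra.
Qed.

(** The second difference of step [k] sees both sides of the origin for [|x| < k];
on the middle interval [[-2k, 2k]] the bound [2 L k] suffices, since its length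
supplies the other factor [k]. *)
Lemma sdiff_L1 g V L k B Y : 0 < k -> 2 * k <= B ->
  (forall x, g (- x) = g x) ->
  (forall x y, `|g x - g y| <= L * `|x - y|) ->
  concavity_controlled g V L ->
  antiderivative Y (fun x => `|sdiff k g x|) ->
  Y B - Y (- B) <= (12 * L + 16 * V) * k ^+ 2.
Proof.
move=> k0 kB ge gL HJ dY.
have right := sdiff_side_L1 k0 kB gL HJ dY.
have dY' : antiderivative (fun x => - Y (- x)) (fun x => `|sdiff k g x|).
  apply: (antider_eq (antiderN (antider_opp dY))) => x; rewrite opprK.
  congr `| _ |; rewrite /sdiff ge -(ge (x + k)) -(ge (x - k)) opprD !opprB.
  by rewrite [k - x]addrC; ring.
have left := sdiff_side_L1 k0 kB gL HJ dY'.
have k2 : - (2 * k) <= 2 * k by lra.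
have [c _ E] := der_mvt k2 (fun x _ => dY x).
have : `|sdiff k g c| * (2 * k - - (2 * k)) <= 8 * L * k ^+ 2.
  have -> : 8 * L * k ^+ 2 = (2 * L * k) * (2 * k - - (2 * k)) by ring.
  apply: ler_wpM2r; first lra.
  have := gL (c + k) c; have := gL (c - k) c.
  have -> : c + k - c = k by ring.
  have -> : c - k - c = - k by ring.
  by rewrite normrN (gtr0_norm k0) /sdiff !ler_norml; lra.
rewrite -E; lra.
Qed.

(** Integrate by parts with the double Steklov average [gk] of [g] instead of [g]:
it is twice differentiable with second derivative [D g / k^2], and it is within
[L k] of [g]. *)
Lemma integral_deriv2_le g L C (phi phi1 phi2 K : R -> R) A :
  (forall x y, `|g x - g y| <= L * `|x - y|) ->
  (forall k B Y, 0 < k -> 2 * k <= B -> antiderivative Y (fun x => `|sdiff k g x|) ->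
    Y B - Y (- B) <= C * k ^+ 2) ->
  antiderivative phi phi1 -> antiderivative phi1 phi2 -> continuous phi2 ->
  (forall x, `|phi x| <= 1) -> 0 < A -> 
  phi A = 0 -> phi (- A) = 0 -> phi1 A = 0 -> phi1 (- A) = 0 ->
  antiderivative K (fun x => g x * phi2 x) -> K A - K (- A) <= C.
Proof.
move=> gL HC d1 d2 c2 phi_le1 A0 pA pNA p1A p1NA dK.
have cg := lipschitz_cts gL.
have [G _ dG] := antiderivative_ex cg.
have [G2 _ dG2] := antiderivative_ex (der_continuous dG).
have [M _ dM] := antiderivative_ex (cts_norm c2).
apply: (@le_linear_eps _ _ _ (L * (M A - M (- A))) (A / 2)) => [|k /andP[k0 kA]]; first lra.
have k20 : 0 < k ^+ 2 by rewrite exprn_gt0.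
pose c := (k ^+ 2)^-1; have c0 : 0 < c by rewrite invr_gt0.
pose gk x := c * sdiff k G2 x.
have e1 : antiderivative gk (fun x => c * sdiff k G x) := antiderZ c (der_sdiff k dG2).
have e2 : antiderivative (fun x => c * sdiff k G x) (fun x => c * sdiff k g x) :=
  antiderZ c (der_sdiff k dG).
have cgk : continuous gk := der_continuous e1.
have gkg x : `|gk x - g x| <= L * k := steklov_close x gL k0 dG dG2.
have [Kk _ dKk] := antiderivative_ex (ctsM cgk c2).
have cs := cts_sdiff (h := k) cg.
have [N _ dN] := antiderivative_ex (ctsM (ctsZ c cs) (der_continuous d1)).
have [Y _ dY] := antiderivative_ex (cts_norm cs).
have AA : - A <= A by lra.
have parts : Kk A - Kk (- A) = N A - N (- A).
  have dP : antiderivative (fun x => gk x * phi1 x - c * sdiff k G x * phi x)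
      (fun x => gk x * phi2 x - c * sdiff k g x * phi x).
    move=> x; apply: is_derive_eq (derB (derM (e1 x) (d2 x)) (derM (e2 x) (d1 x))) _.
    ring.
  have := der_unique AA (fun x _ => dP x) (fun x _ => antiderB dKk dN x).
  rewrite pA pNA p1A p1NA; lra.
have NY : N A - N (- A) <= c * Y A - c * Y (- A).
  apply: (der_le AA (fun x _ => dN x) (fun x _ => antiderZ c dY x)) => x _.
  rewrite -mulrA; apply: ler_wpM2l; first exact: ltW.
  rewrite (le_trans (ler_norm _))// normrM.
  by rewrite ler_piMr.
have YC : c * Y A - c * Y (- A) <= C.
  rewrite -mulrBr /c ler_pdivrMl// mulrC; apply: HC => //; lra.
have : K A - K (- A) <= (Kk A + L * k * M A) - (Kk (- A) + L * k * M (- A)).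
  apply: (der_le AA (fun x _ => dK x) (fun x _ => antiderD dKk (antiderZ (L * k) dM) x)) => x _.
  rewrite -lerBlDl -mulrBl (le_trans (ler_norm _))// normrM ler_wpM2r//.
  by rewrite distrC.
lra.
Qed.

End Variation.

(** * Conclusion *)

Section Conclusion.
Context {R : realType}.
Notation mu := (@lebesgue_measure R).
Implicit Types (f g phi : R -> R) (V : R).

Lemma integral_eq_off0 (u w : R -> R) (D : set R) : measurable D ->
  measurable_fun setT u -> measurable_fun setT w -> (forall x, x != 0 -> u x = w x) ->
  (\int[mu]_(x in D) (u x)%:E = \int[mu]_(x in D) (w x)%:E)%E.
Proof.
move=> mD mu_ mw uw.
have mD0 : measurable (D `\ 0) by exact: measurableD.
rewrite -(@integral_setD1 _ _ 0)//; last first.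
  by apply/measurable_EFinP; exact: (measurable_funTS mu_).
rewrite -(@integral_setD1 _ (fun x => (w x)%:E) 0)//; last first.
  by apply/measurable_EFinP; exact: (measurable_funTS mw).
apply: eq_integral => x; rewrite inE => -[_ /eqP x0].
by rewrite uw.
Qed.

(** Monotonicity and evenness say nothing about [f 0], which may be any number;
neither the averages nor the tested integrals see it. *)
Lemma lipschitz_at_origin f V : 0 <= V -> (forall x, f (- x) = f x) ->
  (forall x y, 0 < x -> x <= y -> f y <= f x) ->
  (forall x y, 0 < x -> x < y -> f x - f y <= V * (y - x)) ->
  exists f', [/\ forall x, x != 0 -> f' x = f x,
    forall x y, `|f' x - f' y| <= V * `|x - y|, forall x, f' (- x) = f' x &
    forall x y, `|x| <= `|y| -> f' y <= f' x].
Proof.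
move=> V0 fe fm fL.
pose S := [set f y | y in [set y | 0 < y]].
have S0 y : 0 < y -> ubound S (f y + V * y).
  move=> y0 _ [z /= z0 <-]; have [zy|yz] := ltP z y.
    have := fL z y z0 zy; have : 0 <= V * z by rewrite mulr_ge0// ltW.
    lra.
  have := fm y z y0 yz; have : 0 <= V * y by rewrite mulr_ge0// ltW.
  lra.
have Sne : S !=set0 by exists (f 1); exists 1 => //=; exact: ltr01.
have Sup : has_ubound S by exists (f 1 + V * 1); exact: S0.
pose f' x := if x == 0 then sup S else f x.
have f'0 : f' 0 = sup S by rewrite /f' eqxx.
have f'E x : x != 0 -> f' x = f x by rewrite /f' => /negbTE ->.
have f'e x : f' (- x) = f' x by rewrite /f' oppr_eq0 fe.
have f'n x : f' x = f' `|x|.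
  by have [x0|x0] := leP 0 x; [rewrite ger0_norm|rewrite ltr0_norm// f'e].
have key x y : 0 <= x -> x <= y -> 0 <= f' x - f' y <= V * (y - x).
  rewrite le_eqVlt => /predU1P[<-|x0]; rewrite le_eqVlt => /predU1P[<-|xy].
  - by rewrite !subrr mulr0 lexx.
  - rewrite f'0 f'E ?gt_eqF// subr0; apply/andP; split.
      by rewrite subr_ge0; apply: ub_le_sup => //; exists y.
    by rewrite lerBlDl; apply: ge_sup => //; exact: S0.
  - by rewrite !subrr mulr0 lexx.
  - rewrite !f'E ?gt_eqF//; last lra.
    by rewrite fL// andbT subr_ge0 fm// ltW.
exists f'; split => // x y.
  rewrite (f'n x) (f'n y); apply: (@le_trans _ _ (V * `| `|x| - `|y| |)).
    have [xy|/ltW yx] := leP `|x| `|y|.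
      have := key _ _ (normr_ge0 x) xy => /andP[A1 A2].
      by rewrite (ger0_norm A1) (ler0_norm (x := `|x| - `|y|)) ?opprB// subr_le0.
    have := key _ _ (normr_ge0 y) yx => /andP[A1 A2].
    by rewrite distrC (ger0_norm A1) (ger0_norm (x := `|x| - `|y|))// subr_ge0.
  by rewrite ler_wpM2l// ler_dist_dist.
move=> xy; rewrite (f'n x) (f'n y).
by have := key _ _ (normr_ge0 x) xy; rewrite subr_ge0 => /andP[].
Qed.

Lemma var_deriv_maximal_le f V : 0 <= V -> measurable_fun setT f ->
  elocally_integrable (EFin \o f) ->
  (forall x, f (- x) = f x) -> (forall x y, 0 < x -> x <= y -> f y <= f x) ->
  tested f V -> (var_deriv (maximal f) <= (28 * V)%:E)%E.
Proof.
move=> V0 mf fi fe fm fV.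
have [|f' [f'E f'L f'e f'm]] := lipschitz_at_origin V0 fe fm.
  move=> x y x0 xy; have := tested_lipschitz fi fe fm fV x0 xy.
  have : 0 <= V * (y - x) by rewrite mulr_ge0; lra.
  lra.
have cf' := lipschitz_cts f'L.
have mf' : measurable_fun setT f' by exact: continuous_measurable_fun.
have f'V : tested f' V.
  move=> psi tpsi; apply: le_trans (fV psi tpsi).
  have [[_ _ c2 _] _] := tpsi.
  have mpsi : measurable_fun setT (derive1n 2 psi).
    exact: continuous_measurable_fun.
  under eq_integral do rewrite -EFinM; under [leRHS]eq_integral do rewrite -EFinM.
  rewrite (@integral_eq_off0 _ (fun x => f x * derive1n 2 psi x))//.
  - exact: measurable_funM.
  - exact: measurable_funM.
  - by move=> x x0; rewrite f'E.
have -> : maximal f = maximal f'.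
  apply/funext => x; rewrite /maximal; congr ereal_sup.
  by apply: eq_imagel => -[a b] _ /=; rewrite /average (@integral_eq_off0 f' f).
have [F F0 dF] := antiderivative_ex cf'.
have [g [gE g_ge g_le]] := maximal_real f'L f'm dF.
have gL := maximal_lipschitz f'L dF g_ge g_le.
have ge := maximal_even f'e dF F0 g_ge g_le.
have cg := lipschitz_cts gL.
have mgE : maximal f' = EFin \o g by apply/funext => x; rewrite gE.
have gi : elocally_integrable (maximal f').
  move=> D cD; rewrite mgE; apply: continuous_compact_integrable => //.
  by apply: continuous_subspaceT.
rewrite /var_deriv asboolT//; apply: ge_ereal_sup => _ [phi tphi <-].
have [A [A0 p0 p1 p2]] := test2_support tphi.
have [[e1 e2 c2 _] phi_le1] := tphi.
have d1 : antiderivative phi (derive1 phi).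
  by move=> x; rewrite derive1E; exact/derivableP.
have d2 : antiderivative (derive1 phi) (derive1n 2 phi).
  by move=> x; rewrite /derive1n/= [X in is_derive _ _ _ X]derive1E; exact/derivableP.
rewrite (@integral_supported_segment _ _ (A + 1)); last first.
  by move=> x Ax; rewrite p2 ?mule0//; lra.
have [K _ dK] := antiderivative_ex (ctsM cg c2).
under eq_integral do rewrite gE -EFinM.
rewrite (FTC_antiderivative (ctsM cg c2) dK); last lra.
have An : A < `|A + 1| by rewrite gtr0_norm; lra.
rewrite lee_fin; apply: (integral_deriv2_le gL _ d1 d2 c2 phi_le1 _ _ _ _ _ dK).
- move=> k B Y k0 kB dY; have -> : 28 * V = 12 * V + 16 * V by ring.
  apply: (sdiff_L1 k0 kB ge gL _ dY).
  exact: (maximal_sdiff f'L f'e f'm dF F0 g_ge g_le f'V).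
- lra.
- exact: p0.
- by apply: p0; rewrite normrN.
- exact: p1.
- by apply: p1; rewrite normrN.
Qed.

End Conclusion.

Theorem theorem1p2 (R : realType) :
  exists C : R, 0 < C /\
    forall f : R -> R,
      locally_integrable [set: R] f ->
      (forall x : R, f (- x) = f x) ->
      {in `]0, +oo[ &, nonincreasing_fun f} ->
      (var_deriv (maximal f) <= C%:E * var_deriv (EFin \o f))%E.
Proof.
exists 28; split => // f [mf _ _] fe fm.
have [fi|nfi] := pselect (elocally_integrable (EFin \o f)); last first.
  by rewrite [X in (_ * X)%E]/var_deriv asboolF// gt0_muley ?leey// lte_fin.
have ub phi : test2 phi ->
    (\int[lebesgue_measure]_x ((f x)%:E * (derive1n 2 phi x)%:E) <=
     var_deriv (EFin \o f))%E.
  by move=> tphi; rewrite /var_deriv asboolT//; apply: ereal_sup_ubound; exists phi.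
have V0 : (0 <= var_deriv (EFin \o f))%E.
  have t0 : test2 (fun _ : R => 0 : R).
    apply: (@test2_antiderivative _ _ (fun=> 0) (fun=> 0) 0) => //.
    - exact: der_cst.
    - exact: der_cst.
    - exact: cts_cst.
    - by move=> x; rewrite normr0.
  apply: le_trans (ub _ t0); rewrite integral0_eq// => x _.
  have z : antiderivative (fun _ : R => 0 : R) (fun=> 0) by exact: der_cst.
  by rewrite /derive1n/= !(derive1_antiderivative z) mule0.
move: V0 ub; case: (var_deriv (EFin \o f)) => [V| |] //; last first.
  by rewrite gt0_muley ?leey// lte_fin.
rewrite lee_fin => V0 ub; rewrite -EFinM; apply: var_deriv_maximal_le => // x y x0 xy.
by apply: fm => //; rewrite in_itv/= andbT//; lra.
Qed.
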